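(* Let $\lambda,\mu$ be partitions with $\mu\subset\lambda$ and $\ell=\ell(\lambda)\le n$. Then \[ |\mathrm{SSCT}_n(\lambda/\mu)|=\det\left(\binom{\lambda_i+n-i}{\mu_j+n-j}\right)_{1\le i,j\le \ell} =\frac{|\mathrm{SYT}(\lambda/\mu)|}{|\lambda/\mu|!}\prod_{x\in\lambda/\mu}(n+c(x)). \]
   Context: $\mathbb N=\{0,1,2,\dots\}$. A partition $\lambda=(\lambda_1\ge\dots\ge\lambda_k>0)$ has length $\ell(\lambda)=k$, and $\lambda_i=0$ for $i>\ell(\lambda)$. It is identified with its Young diagram $\{(i,j):1\le i\le \ell(\lambda),\,1\le j\le\lambda_i\}$; $\mu\subset\lambda$ means containment of diagrams, $\lambda/\mu$ is the set difference, and $|\lambda/\mu|$ its number of cells. The content of a cell is $c(i,j)=j-i$. A tableau of shape $\lambda/\mu$ is a map $\lambda/\mu\to\mathbb N$. $\mathrm{SYT}(\lambda/\mu)$ is the set of standard Young tableaux: tableaux of shape $\lambda/\mu$ in which each integer $1,\dots,|\lambda/\mu|$ appears exactly once and entries are decreasing along each row (left to right) and each column (top to bottom). $\mathrm{SSCT}_n(\lambda/\mu)$ is the set of semistandard $n$-content tableaux: tableaux $S$ of shape $\lambda/\mu$ with entries weakly decreasing along rows and strictly decreasing down columns, and with $0\le S(i,j)<n-i+j$ for every $(i,j)\in\lambda/\mu$. *)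

(* Defs.v *)
From mathcomp Require Import all_boot all_order all_algebra.
From mathcomp Require Import finmap.
From mathcomp Require Import boolp classical_sets functions cardinality.

Set Implicit Arguments.
Unset Strict Implicit.
Unset Printing Implicit Defensive.

Import Order.TTheory GRing.Theory Num.Theory.

(* A partition is the list of its positive parts, so its length is [size]. *)
Definition is_partition (la : seq nat) : bool :=
  sorted geq la && (0 \notin la).

(* Parts are numbered from 1; [part la 0] is a junk value. *)
Definition part (la : seq nat) (i : nat) : nat := nth 0 la i.-1.

Definition diagram (la : seq nat) : {fset nat * nat} :=
  [fset x in [seq (i, j) | i <- iota 1 (size la), j <- iota 1 (part la i)]]%fset.

Definition skew_diagram (la mu : seq nat) : {fset nat * nat} :=
  (diagram la `\` diagram mu)%fset.

Definition content (x : nat * nat) : int := (x.2%:Z - x.1%:Z)%R.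

Section Tableaux.
Variable D : {fset nat * nat}.
Local Notation tableau := {ffun D -> nat}.
Implicit Types (T : tableau) (x y : D).

Definition same_row_lt x y : Prop :=
  (val x).1 = (val y).1 /\ (val x).2 < (val y).2.
Definition same_col_lt x y : Prop :=
  (val x).2 = (val y).2 /\ (val x).1 < (val y).1.

Definition is_SYT T : Prop :=
  [/\ forall k, 1 <= k <= #|` D| -> exists! x, T x = k,
      forall x y, same_row_lt x y -> T y < T x &
      forall x y, same_col_lt x y -> T y < T x].

Definition is_SSCT (n : nat) T : Prop :=
  [/\ forall x y, same_row_lt x y -> T y <= T x,
      forall x y, same_col_lt x y -> T y < T x &
      forall x,
        ((T x)%:Z < n%:Z - (val x).1%:Z + (val x).2%:Z)%R].

Definition SYT : set tableau := [set T | is_SYT T]%classic.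
Definition SSCT (n : nat) : set tableau := [set T | is_SSCT n T]%classic.

Lemma finite_bounded_tableaux (A : set tableau) (b : nat) :
  (forall T, A T -> forall x, T x < b) -> finite_set A.
Proof.
move=> Ab; pose f (g : {ffun D -> 'I_b}) : tableau := [ffun x => val (g x)].
have fin : finite_set (f @` [set: {ffun D -> 'I_b}])%classic.
  exact/finite_image/finite_finset.
apply: sub_finite_set fin => T AT.
exists [ffun x => Ordinal (Ab T AT x)] => //.
by apply/ffunP => x; rewrite !ffunE.
Qed.

Lemma finite_SSCT n : finite_set (SSCT n).
Proof.
apply: (@finite_bounded_tableaux _ (n + \max_(x : D) (val x).2)).
move=> T [_ _ bT] x.
rewrite -ltz_nat; apply: lt_le_trans (bT x) _.
rewrite PoszD lerD ?gerBl // lez_nat.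
exact: (leq_bigmax x).
Qed.

Lemma finite_SYT : finite_set SYT.
Proof.
apply: (@finite_bounded_tableaux _ #|` D|.+1) => T [oneT _ _].
have ex (k : 'I_#|` D|) : exists x, T x == k.+1.
  have [|x [/eqP Tx _]] := oneT k.+1; first exact: ltn_ord.
  by exists x.
pose f k := xchoose (ex k).
have fE k : T (f k) = k.+1 by apply/eqP/(xchooseP (ex k)).
have f_inj : injective f.
  by move=> i j eqf; apply/val_inj/succn_inj; rewrite -!fE eqf.
move=> x; have : x \in codom f.
  by rewrite inj_card_onto // card_ord cardfE.
by case/codomP=> k ->; rewrite fE ltnS.
Qed.

End Tableaux.

Arguments SYT D : clear implicits.
Arguments SSCT D n : clear implicits.

(* [fset_set] returns the empty set on infinite sets; [finite_SYT] and
   [finite_SSCT] show that this never happens here. *)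
Definition num_SYT (D : {fset nat * nat}) : nat := #|` fset_set (SYT D)|%fset.
Definition num_SSCT (n : nat) (D : {fset nat * nat}) : nat :=
  #|` fset_set (SSCT D n)|%fset.

(* Main.v *)
Require Import Defs.
From mathcomp Require Import all_boot all_order all_algebra.
From mathcomp Require Import finmap perm.
From mathcomp Require Import boolp classical_sets cardinality.
From mathcomp Require Import zify.

Set Implicit Arguments.
Unset Strict Implicit.
Unset Printing Implicit Defensive.

Import GRing.Theory Num.Theory.

(** Both equalities come from taking one cell at a time off the inner border
    of [lambda / mu], that is, from adding one box to [mu], and comparing with
    determinants [\det (psi_j (a_i, b_j))] in the beta numbers
    [a_i = lambda_i + n - i] and [b_j = mu_j + n - j].  Adding a box to row [r]
    of [mu] replaces [b_r] by [b_r + 1] and changes nothing else.  If the box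
    cannot be added, the new determinant has two equal columns or a large block
    of zeros, and vanishes ([det_beta_mx_add_box0]); so the combinatorial and
    the algebraic recursions run over the same boxes.

    First equality.  Since rows decrease weakly, the content bound says that
    the entries of row [i] are at most [b_i].  The statement proved by
    induction ([flagged_count]) allows any weakly decreasing flag [q], with the
    entries of row [i] below [q_i], and the entry
    [h_{a-b}(1^{q_j}) = binomial (a - b + q_j - 1, a - b)], which is
    [binomial (a, b)] when [q_j = b + 1].  Choose the first row [r] with
    [q_{r+1} < q_r].  Either all entries of row [r] are less than [q_r - 1], and
    then [q_r] can be lowered by one, or the first entry equals [q_r - 1], and
    then its cell is an inner corner that can be removed.  On the determinant
    side this is Pascal's rule [h_m(1^q) = h_m(1^{q-1}) + h_{m-1}(1^q)] in
    column [r] ([det_hmx_recursion]).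

    Second equality.  Factorials pulled out of rows and columns turn
    [binomial (a_i, b_j)] into [1 / (a_i - b_j)!], and the quotient
    [\prod a_i! / \prod b_j!] is the product of the [n + c(x)]
    ([prod_contents]).  What remains is Aitken's formula
    [f = N! \det (1 / (a_i - b_j)!)] for the number of standard tableaux with
    [N] cells ([standard_count]): the largest entry sits in an inner corner,
    and removing it gives [f = \sum_r f_r], while
    [1 / (a - b - 1)! = (a - b) / (a - b)!] and the Leibniz expansion give
    [N \det = \sum_r \det_r]. *)

(** * Counting finite sets *)

(** Finiteness is part of this relation, so that the recursions below establish
    it together with the cardinality. *)
Definition has_card (T : choiceType) (A : set T) (k : nat) : Prop :=
  exists2 F : {fset T}, A = [set` F]%classic & #|` F| = k.

Lemma card_fset_set (T : choiceType) (A : set T) k :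
  has_card A k -> #|` fset_set A| = k.
Proof. by case=> F -> <-; rewrite set_fsetK. Qed.

Lemma eq_has_card (T : choiceType) (A B : set T) k :
  (forall x, A x <-> B x) -> has_card A k -> has_card B k.
Proof.
move=> AB [F eA cF]; exists F => //; rewrite -eA.
by apply/esym/funext => x; apply/propext.
Qed.

Lemma has_card0 (T : choiceType) (A : set T) :
  (forall x, ~ A x) -> has_card A 0.
Proof.
move=> nA; exists fset0; last exact: cardfs0.
by apply/funext => x; apply/propext; rewrite /= inE; split => // /nA.
Qed.

Lemma has_card1 (T : choiceType) (A : set T) a :
  (forall x, A x <-> x = a) -> has_card A 1.
Proof.
move=> A1; exists [fset a]%fset; last exact: cardfs1.
by apply/funext => x; apply/propext; rewrite /= inE A1; split => /eqP.
Qed.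

Lemma has_cardU (T : choiceType) (A B C : set T) j k :
  (forall x, C x <-> A x \/ B x) -> (forall x, A x -> B x -> False) ->
  has_card A j -> has_card B k -> has_card C (j + k).
Proof.
move=> CAB dAB [F eA cF] [G eB cG]; exists (F `|` G)%fset.
  apply/funext => x; apply/propext; rewrite /= inE CAB eA eB /=.
  by split=> /orP.
rewrite cardfsU cF cG.
have -> : (F `&` G)%fset = fset0.
  apply/fsetP => x; rewrite !inE; apply/negP => /andP[xF xG].
  by apply: (dAB x); rewrite ?eA ?eB.
by rewrite cardfs0 subn0.
Qed.

Lemma has_card_sum (T : choiceType) l (P : 'I_l -> bool) (A : 'I_l -> set T)
    (B : set T) (k : 'I_l -> nat) :
  (forall x, B x <-> exists2 i, P i & A i x) ->
  (forall i j x, A i x -> A j x -> i = j) ->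
  (forall i, P i -> has_card (A i) (k i)) -> has_card B (\sum_(i | P i) k i).
Proof.
move=> BA dA cA.
have gen (s : seq 'I_l) : uniq s ->
    has_card (fun x => exists2 i, (i \in s) && P i & A i x)
      (\sum_(i <- s | P i) k i).
  elim: s => [_|i s IH /=/andP[iNs us]].
    by rewrite big_nil; apply: has_card0 => x [].
  rewrite big_cons; case: ifPn => Pi; last first.
    apply: eq_has_card (IH us) => x; split=> -[j]; rewrite ?inE.
      by move=> /andP[js Pj] Aj; exists j; rewrite // inE js orbT.
    by case: eqP => [->|_ js]; [rewrite (negPf Pi) | exists j].
  apply: has_cardU (cA i Pi) (IH us) => x.
    split=> [[j]|[Ai|[j /andP[js Pj] Aj]]].
    - by rewrite inE; case: eqP => [-> _|_ js]; [left | right; exists j].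
    - by exists i; rewrite // inE eqxx.
    - by exists j; rewrite // inE js orbT.
  by move=> Ai [j /andP[js _] /(dA _ _ _ Ai) eij]; rewrite eij js in iNs.
apply: eq_has_card (gen (index_enum 'I_l) (index_enum_uniq _)) => x.
by rewrite BA; split=> -[i iP Ai]; exists i; rewrite ?mem_index_enum // in iP *.
Qed.

Lemma has_card_bij (T U : choiceType) (A : set T) (B : set U) f g k :
  (forall x, A x -> B (f x) /\ g (f x) = x) ->
  (forall y, B y -> A (g y) /\ f (g y) = y) ->
  has_card A k -> has_card B k.
Proof.
move=> fP gP [F eA <-]; exists (f @` F)%fset.
  apply/funext => y; apply/propext; split=> /= [/gP[Ag <-]|/imfsetP[x /= xF ->]].
    by apply/imfsetP; exists (g y); rewrite //; move: Ag; rewrite eA.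
  by apply: (fP _ _).1; rewrite eA.
rewrite card_in_imfset // => x y xF yF eqf.
have [_ <-] : B (f x) /\ g (f x) = x by apply: fP; rewrite eA.
have [_ <-] : B (f y) /\ g (f y) = y by apply: fP; rewrite eA.
by rewrite eqf.
Qed.

(** * Determinants *)

Section Determinants.
Local Open Scope ring_scope.

(** A permutation without a factor in the block would map the indices up to
    [r] injectively below [r]. *)
Lemma det_block0 (R : comNzRingType) l (M : 'M[R]_l) (r : 'I_l) :
  (forall i j : 'I_l, (i <= r <= j)%N -> M i j = 0) -> \det M = 0.
Proof.
move=> M0; rewrite /determinant big1 // => s _.
have [i ir ris] : exists2 i : 'I_l, (i <= r)%N & (r <= s i)%N.
  apply/exists_inP; apply: contraT => /exists_inPn Ns.
  have sub : [set s i | i in [set i : 'I_l | (i <= r)%N]]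
             \subset [set i : 'I_l | (i < r)%N].
    apply/fintype.subsetP => x /imsetP[i ir ->{x}]; rewrite inE in ir.
    by rewrite inE ltnNge Ns.
  have cardlt k (kl : (k <= l)%N) : #|[set i : 'I_l | (i < k)%N]| = k.
    have inj : injective (widen_ord kl) by move=> i j /(congr1 val)/= /val_inj.
    rewrite -[RHS]card_ord -(card_imset _ inj).
    apply: eq_card => i; rewrite !inE; apply/idP/imsetP => [ik|[j _ ->]].
      by exists (Ordinal ik); rewrite ?inE //; apply/val_inj.
    by rewrite /= ltn_ord.
  have := subset_leq_card sub; rewrite card_imset; last exact: perm_inj.
  by rewrite (cardlt r.+1 (ltn_ord r)) (cardlt r (ltnW (ltn_ord r))) ltnn.
by rewrite (bigD1 i) //= M0 ?ir // mul0r mulr0.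
Qed.

Lemma det_split_row (R : comNzRingType) l (M M1 M2 : 'M[R]_l) (r : 'I_l) :
  (forall j, M r j = M1 r j + M2 r j) ->
  (forall i j, i != r -> M1 i j = M i j /\ M2 i j = M i j) ->
  \det M = \det M1 + \det M2.
Proof.
move=> Mr Mi; rewrite (@determinant_multilinear _ _ M M1 M2 r 1 1) ?mul1r //.
- by apply/rowP => j; rewrite !mxE !mul1r.
- by apply/matrixP => i j; rewrite !mxE (Mi _ _ _).1 // eq_sym neq_lift.
- by apply/matrixP => i j; rewrite !mxE (Mi _ _ _).2 // eq_sym neq_lift.
Qed.

(** The Leibniz expansion turns a scaling of the single row [i] by
    [a j - b i], summed over [i], into a scaling of every term by
    [\sum_i (a (s i) - b i)], which does not depend on the permutation [s]. *)
Lemma sum_det_scaled_row (R : comNzRingType) l (M : 'M[R]_l) (a b : 'I_l -> R)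
    (N : 'I_l -> 'M[R]_l) :
  (forall r j, N r r j = (a j - b r) * M r j) ->
  (forall r i j, i != r -> N r i j = M i j) ->
  \sum_r \det (N r) = (\sum_i a i - \sum_i b i) * \det M.
Proof.
move=> Nr Ni; rewrite /determinant exchange_big mulr_sumr.
apply: eq_bigr => s _ /=; rewrite -mulr_sumr mulrCA; congr (_ * _).
rewrite [\sum_i a i](reindex_inj (@perm_inj _ s)) -sumrB mulr_suml.
apply: eq_bigr => r _.
rewrite (bigD1 r) //= Nr -mulrA [in RHS](bigD1 r) //=; congr (_ * (_ * _)).
by apply: eq_bigr => i ir; rewrite Ni.
Qed.

Lemma det_scale_rows_cols (R : comNzRingType) l (M : 'M[R]_l)
    (u v : 'I_l -> R) :
  \det (\matrix_(i, j) (u i * M i j * v j)) =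
  (\prod_i u i) * \det M * (\prod_j v j).
Proof.
have -> : \matrix_(i, j) (u i * M i j * v j) =
    diag_mx (\row_i u i) *m M *m diag_mx (\row_j v j).
  by apply/matrixP => i j; rewrite mul_mx_diag mul_diag_mx !mxE.
by rewrite !det_mulmx !det_diag; congr (_ * _ * _);
   apply: eq_bigr => i _; rewrite mxE.
Qed.

End Determinants.

(** * Shapes and beta numbers *)

Definition nonincreasing (s : nat -> nat) : Prop := forall i, s i.+1 <= s i.

Lemma nonincreasingP (s : nat -> nat) i j :
  nonincreasing s -> i <= j -> s j <= s i.
Proof.
move=> ds /subnK <-; elim: (j - i) => // k IH.
exact: leq_trans (ds _) IH.
Qed.

(** Rows and columns are numbered from 0 here, and a partition is a
    function with value 0 from some row on. *)
Definition in_skew (lam mu : nat -> nat) (x : nat * nat) : bool :=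
  mu x.1 <= x.2 < lam x.1.

Definition add_box (mu : nat -> nat) (r : nat) : nat -> nat :=
  fun i => mu i + (i == r).

Definition addable (lam mu : nat -> nat) (r : nat) : bool :=
  (mu r < lam r) && ((r == 0) || (mu r < mu r.-1)).

Lemma in_skew_add_box lam mu r x :
  in_skew lam (add_box mu r) x = in_skew lam mu x && (x != (r, mu r)).
Proof.
case: x => i j; rewrite /in_skew /add_box xpair_eqE /=.
by case: eqP => [->|_]; rewrite ?addn0 ?andbT //; lia.
Qed.

Lemma add_box_nonincreasing lam mu r :
  nonincreasing mu -> addable lam mu r -> nonincreasing (add_box mu r).
Proof.
move=> dmu /andP[_ ra] i; have := dmu i; rewrite /add_box.
case: (i.+1 =P r) => [ri|_]; last by case: eqP; lia.
by move: ra; rewrite -ri; case: eqP => /=; lia.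
Qed.

Lemma add_box_le lam mu r :
  (forall i, mu i <= lam i) -> addable lam mu r ->
  forall i, add_box mu r i <= lam i.
Proof.
move=> le /andP[lr _] i; rewrite /add_box.
by case: eqP => [->|_]; have := le i; lia.
Qed.

Definition beta (n : nat) (s : nat -> nat) (i : nat) : nat := s i + n - i.+1.

Lemma beta_lt n s i j :
  nonincreasing s -> i < j -> j < n -> beta n s j < beta n s i.
Proof.
by move=> ds ij jn; have := nonincreasingP ds (ltnW ij); rewrite /beta; lia.
Qed.

Section BetaMatrix.
Local Open Scope ring_scope.
Variables (l n : nat) (lam mu : nat -> nat).
Hypothesis (ln : (l <= n)%N).
Hypothesis (dlam : nonincreasing lam) (dmu : nonincreasing mu).

(** The common form of the determinants of this file, transposed so that
    adding a box to [mu] alters a single row.  The entry function may depend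
    on the row, which is how flags come in. *)
Definition beta_mx (psi : nat -> nat -> nat -> rat) (nu : nat -> nat)
    : 'M[rat]_l :=
  \matrix_(j, i) psi j (beta n lam i) (beta n nu j).

Variable psi : nat -> nat -> nat -> rat.
Hypothesis psi0 : forall j a b, (a < b)%N -> psi j a b = 0.

Lemma det_beta_mx_diag :
  (forall j a, psi j a a = 1) -> (forall i, mu i = lam i) ->
  \det (beta_mx psi mu) = 1.
Proof.
move=> psi1 eml; rewrite det_trig.
  by rewrite big1 // => i _; rewrite mxE /beta eml psi1.
apply/forallP => i; apply/forallP => j; apply/implyP => ij; apply/eqP.
rewrite mxE psi0 // /beta eml -!/(beta n lam _); apply: beta_lt => //.
exact: leq_trans (ltn_ord j) ln.
Qed.

(** An illegal box either makes two rows of the matrix equal or sticks out of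
    [lam], and then the rows up to [r] vanish from the column [r] on. *)
Lemma det_beta_mx_add_box0 r :
  (r < l)%N -> ~~ addable lam mu r ->
  ((0 < r)%N -> forall a b, psi r.-1 a b = psi r a b) ->
  \det (beta_mx psi (add_box mu r)) = 0.
Proof.
move=> rl; rewrite negb_and -leqNgt => /orP[lr _|].
  apply: (@det_block0 _ _ _ (Ordinal rl)) => i j /= /andP[ir rj].
  rewrite mxE psi0 // /beta /add_box.
  have := nonincreasingP dlam rj; have := nonincreasingP dmu ir.
  have := ltn_ord j; case: eqP; lia.
rewrite negb_or -leqNgt => /andP[r0 mur] /(_ _) psiE.
have pl : (r.-1 < l)%N by lia.
have := dmu r.-1; rewrite prednK ?lt0n // => mur'.
apply: (@determinant_alternate _ _ _ (Ordinal pl) (Ordinal rl)).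
  by apply/eqP => /(congr1 val) /=; lia.
move=> j; rewrite !mxE /= psiE ?lt0n //; congr psi.
by rewrite /beta /add_box eqxx; case: eqP; lia.
Qed.

End BetaMatrix.

(** * Tableaux as functions on the plane *)

(** A tableau is extended by 0 outside its shape, so that tableaux of
    different shapes have the same type. *)
Definition flagged (lam mu q : nat -> nat) (f : nat * nat -> nat) : Prop :=
  [/\ forall x, ~~ in_skew lam mu x -> f x = 0,
      forall i j k, in_skew lam mu (i, j) -> in_skew lam mu (i, k) ->
        j < k -> f (i, k) <= f (i, j),
      forall i k j, in_skew lam mu (i, j) -> in_skew lam mu (k, j) ->
        i < k -> f (k, j) < f (i, j) &
      forall i j, in_skew lam mu (i, j) -> f (i, j) < q i].

Definition standard (lam mu : nat -> nat) (N : nat) (f : nat * nat -> nat)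
    : Prop :=
  [/\ forall x, if in_skew lam mu x then 0 < f x <= N else f x == 0,
      forall k, 0 < k <= N -> exists! x, f x = k,
      forall i j k, in_skew lam mu (i, j) -> in_skew lam mu (i, k) ->
        j < k -> f (i, k) < f (i, j) &
      forall i k j, in_skew lam mu (i, j) -> in_skew lam mu (k, j) ->
        i < k -> f (k, j) < f (i, j)].

Definition upd (f : nat * nat -> nat) x v : nat * nat -> nat :=
  fun y => if y == x then v else f y.

Lemma has_card_upd (A B : set (nat * nat -> nat)) x v k :
  (forall f, A f -> f x = v /\ B (upd f x 0)) ->
  (forall g, B g -> g x = 0 /\ A (upd g x v)) ->
  has_card B k -> has_card A k.
Proof.
have updK f u w : f x = w -> upd (upd f x u) x w = f.
  by move=> fx; apply/funext => y; rewrite /upd; case: eqP => // ->.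
move=> AB BA; apply: (@has_card_bij _ _ _ _ (fun g => upd g x v)
  (fun f => upd f x 0)) => [g /BA[]|f /AB[]] ? ?; split=> //; exact: updK.
Qed.

(** * The largest value that a flag allows *)

Definition lower (q : nat -> nat) (r : nat) : nat -> nat :=
  fun i => q i - (i == r).

Lemma lower_nonincreasing q r :
  nonincreasing q -> q r.+1 < q r -> nonincreasing (lower q r).
Proof.
move=> dq qr i; rewrite /lower; have := dq i.
case: (i =P r) => [->|_]; last by lia.
by rewrite gtn_eqF //; lia.
Qed.

Lemma flagged_lower lam mu q r f :
  (forall j, in_skew lam mu (r, j) -> f (r, j) < (q r).-1) ->
  flagged lam mu q f -> flagged lam mu (lower q r) f.
Proof.
move=> fr [f0 frow fcol ff]; split=> // i j D; rewrite /lower.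
by case: eqP => [ir|_]; rewrite ?subn0 ?ff // ir subn1 fr // -ir.
Qed.

Lemma lower_flagged lam mu q r f :
  flagged lam mu (lower q r) f -> flagged lam mu q f.
Proof.
move=> [f0 frow fcol ff]; split=> // i j /ff /leq_trans; apply.
exact: leq_subr.
Qed.

Section FlaggedRecursion.
Variables (lam mu q : nat -> nat) (r : nat).
Hypothesis (dlam : nonincreasing lam) (dmu : nonincreasing mu).
Hypothesis (dq : nonincreasing q).

(** Rows [r.-1] and [r] of the flag agree, so the entry above the first cell of
    row [r], which is below [q r] too, keeps row [r] away from [(q r).-1]. *)
Lemma flagged_not_addable f :
  ~~ addable lam mu r -> (0 < r -> q r.-1 = q r) ->
  flagged lam mu q f <-> flagged lam mu (lower q r) f.
Proof.
move=> nr qE; split; last exact: lower_flagged.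
move=> ff; apply: flagged_lower (ff) => j D.
have [r0 mur mulr] : [/\ 0 < r, mu r.-1 <= mu r & mu r < lam r].
  by move: nr D; rewrite /addable /in_skew /= => nr D; split; lia.
case: ff => f0 frow fcol ff.
have D0 : in_skew lam mu (r, mu r) by rewrite /in_skew leqnn.
have D1 : in_skew lam mu (r.-1, mu r).
  by have := dlam r.-1; rewrite /in_skew /= prednK //; lia.
have := ff _ _ D1; rewrite qE // => f1.
have := fcol _ _ _ D1 D0; rewrite ltn_predL => /(_ r0) f01.
have [->|jm] := eqVneq j (mu r); first by lia.
by have := frow _ _ _ D0 D; move: D; rewrite /in_skew /=; lia.
Qed.

Hypothesis radd : addable lam mu r.
Hypothesis qr : q r.+1 < q r.

(** The descent of the flag after row [r] is what allows the value [(q r).-1] to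
    be put back into the corner: the entries of its column lie in later rows
    and are below [q r.+1]. *)
Lemma flagged_addable k1 k2 :
  has_card (flagged lam mu (lower q r)) k1 ->
  has_card (flagged lam (add_box mu r) q) k2 ->
  has_card (flagged lam mu q) (k1 + k2).
Proof.
have /andP[lr mur] := radd.
have D0 : in_skew lam mu (r, mu r) by rewrite /in_skew leqnn.
have qr0 : 0 < q r by exact: leq_ltn_trans qr.
move=> c1 c2; pose B f := flagged lam mu q f /\ f (r, mu r) = (q r).-1.
have cB : has_card B k2.
  apply: (has_card_upd (x := (r, mu r)) (v := (q r).-1)) c2
    => [f [[f0 frow fcol ff] fx]|g [g0 grow gcol gf]].
    split=> //; split=> [x|i j k|i k j|i j]; rewrite in_skew_add_box /upd.
    - by case: eqP => //= _; rewrite andbT => /f0.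
    - move=> /andP[Dj /negPf ->]; rewrite in_skew_add_box => /andP[Dk /negPf ->].
      exact: frow.
    - move=> /andP[Di /negPf ->]; rewrite in_skew_add_box => /andP[Dk /negPf ->].
      exact: fcol.
    - by move=> /andP[D /negPf ->]; apply: ff.
  have Dg y : in_skew lam mu y -> y != (r, mu r) ->
      in_skew lam (add_box mu r) y by rewrite in_skew_add_box => -> ->.
  split; first by rewrite g0 // in_skew_add_box eqxx andbF.
  split; last by rewrite /upd eqxx.
  split=> [x Dx|i j k Dj Dk jk|i k j Di Dk ik|i j D]; rewrite /upd.
  - case: eqP => [xE|_]; first by rewrite xE D0 in Dx.
    by rewrite g0 // in_skew_add_box negb_and Dx.
  - case: (@eqP _ (i, k)) => [[ei ek]|/eqP nk].
      by move: Dj; rewrite /in_skew /= ei -ek; lia.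
    case: (@eqP _ (i, j)) => [[ei ej]|/eqP nj]; last by apply: grow => //; apply: Dg.
    by have := gf i k (Dg _ Dk nk); rewrite ei; lia.
  - case: (@eqP _ (k, j)) => [[ek ej]|/eqP nk].
      have ir : i <= r.-1 by lia.
      have := nonincreasingP dmu ir.
      by move: Di mur ik; rewrite /in_skew /= ej ek; lia.
    case: (@eqP _ (i, j)) => [[ei ej]|/eqP nj]; last by apply: gcol => //; apply: Dg.
    have := gf k j (Dg _ Dk nk); have := nonincreasingP dq ik; rewrite ei; lia.
  - case: eqP => [[-> _]|/eqP nx]; first by rewrite ltn_predL.
    by apply: gf; apply: Dg.
apply: has_cardU c1 cB => f.
  split=> [ff|[/lower_flagged //|[] //]].
  have [e|ne] := eqVneq (f (r, mu r)) (q r).-1; [by right | left].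
  apply: flagged_lower (ff) => j D; case: ff => _ frow _ /(_ _ _ D0) fx.
  have [->|nj] := eqVneq j (mu r); first by lia.
  by have := frow r (mu r) j D0 D; move: D; rewrite /in_skew /=; lia.
move=> [_ _ _ /(_ _ _ D0)]; rewrite /lower eqxx subn1 => lt [_ eq].
by rewrite eq ltnn in lt.
Qed.

End FlaggedRecursion.

(** * The determinant for flagged tableaux *)

(** The complete homogeneous symmetric polynomial of degree [a - b] evaluated
    at [q] ones: the number of weakly decreasing rows of length [a - b] with
    entries below [q].  For [q = 0] and [a = b] the truncated predecessor still
    gives the correct value 1. *)
Definition hcoef (q a b : nat) : nat :=
  if a < b then 0 else 'C((a - b + q).-1, a - b).

Lemma hcoef_pascal q a b : hcoef q.+1 a b = hcoef q a b + hcoef q.+1 a b.+1.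
Proof.
rewrite /hcoef; case: (ltngtP a b) => [ab|ba|->].
- by rewrite ltnS ltnW.
- rewrite ltnS leqNgt ba /=.
  have -> : a - b = (a - b.+1).+1 by lia.
  by rewrite !addSn !addnS /= binS addnC.
- by rewrite subnn ltnSn !bin0.
Qed.

Lemma hcoef0 a b : hcoef 0 a b = (a == b).
Proof.
rewrite /hcoef; case: ltngtP => [//|ba|->]; last by rewrite subnn.
by rewrite addn0 bin_small //; lia.
Qed.

Lemma hcoef_refl q a : hcoef q a a = 1.
Proof. by rewrite /hcoef ltnn subnn bin0. Qed.

(** The content bound leaves the values from 0 to [b] to a row of [mu] with beta
    number [b], so this is how binomials arise as flagged entries. *)
Lemma hcoef_bin a b : hcoef b.+1 a b = 'C(a, b).
Proof.
rewrite /hcoef; case: ltnP => [/bin_small ->//|ba].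
by rewrite addnS /= subnK // bin_sub.
Qed.

Local Notation hmx l n lam q :=
  (beta_mx l n lam (fun j a b => (hcoef (q j) a b)%:R%R)).

Lemma det_hmx_recursion l n lam mu q r :
  r < l -> l <= n -> 0 < q r ->
  (\det (hmx l n lam q mu) = \det (hmx l n lam (lower q r) mu)
     + \det (hmx l n lam q (add_box mu r)))%R.
Proof.
move=> rl ln q0; apply: (@det_split_row _ _ _ _ _ (Ordinal rl)) => [i|j i jr].
  rewrite !mxE -natrD /lower eqxx subn1; congr (_%:R)%R.
  have -> : beta n (add_box mu r) r = (beta n mu r).+1.
    by rewrite /beta /add_box eqxx; lia.
  by rewrite -{1 3}(prednK q0) hcoef_pascal.
rewrite !mxE /lower /beta /add_box.
have /negPf -> : (j : nat) != r by apply: contra jr => /eqP jr; apply/eqP/val_inj.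
by rewrite subn0 addn0.
Qed.

(** Lowering one flag value at a time matches Pascal's rule in one row of the
    determinant.  The first descent of the flag is a row where this is possible
    while the flag stays weakly decreasing. *)
Theorem flagged_count l n lam mu q :
  l <= n -> nonincreasing lam -> nonincreasing mu -> nonincreasing q ->
  (forall i, mu i <= lam i) -> lam l = 0 -> q l = 0 ->
  exists2 k, has_card (flagged lam mu q) k & (k%:R = \det (hmx l n lam q mu))%R.
Proof.
move=> ln dlam + + + lam0; have [m] := ubnP (\sum_(i < l) (q i + (lam i - mu i))).
elim: m mu q => // m IH mu q sm dmu dq le ql0.
have lamz i : l <= i -> lam i = 0 by move/(nonincreasingP dlam); lia.
have [/eqP q0|qpos] := boolP (q 0 == 0).
  have qz i : q i = 0 by have := nonincreasingP dq (leq0n i); lia.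
  have [eml|[r rnm]] : (forall i, mu i = lam i) \/ exists r, mu r != lam r.
    case: (EM (exists r, mu r != lam r)); first by right.
    by move=> /forallNP nr; left => i; apply/eqP/negP => /negP/nr.
  - exists 1; last first.
      rewrite det_beta_mx_diag //; first by move=> j a b ab; rewrite /hcoef ab.
      by move=> j a; rewrite hcoef_refl.
    apply: (has_card1 (a := fun=> 0)) => f.
    have nD x : ~~ in_skew lam mu x by rewrite /in_skew eml; lia.
    split=> [[f0 _ _ _]|->]; first by apply/funext => x; apply: f0.
    by split=> [//|i j k D|i k j D|i j D]; rewrite (negPf (nD _)) in D.
  - exists 0.
      apply: has_card0 => f [_ _ _ /(_ r (mu r))].
      by rewrite qz ltn0 /in_skew /= => /(_ _); have := le r; lia.
    have rl : r < l.
      by rewrite ltnNge; apply/negP => /lamz lz; have := le r; lia.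
    (* the last row in which the shapes differ gives a zero row *)
    have ex : exists r, (r < l) && (mu r != lam r) by exists r; rewrite rl.
    have ub r' : (r' < l) && (mu r' != lam r') -> r' <= l by case/andP => /ltnW.
    case: (ex_maxnP ex ub) => s /andP[sl snm] smax.
    rewrite (expand_det_row _ (Ordinal sl)) big1 // => i _.
    suff /negPf nb : beta n lam i != beta n mu s by rewrite mxE qz hcoef0 nb mul0r.
    have := le s; have il := ltn_ord i.
    case: (leqP i s) => [is_|si].
      by have := nonincreasingP dlam is_; rewrite /beta; lia.
    have emi : mu i = lam i by apply/eqP/negP => /negP nm; have := smax i; lia.
    by have := nonincreasingP dmu (ltnW si); rewrite /beta; lia.
(* the flag starts positive and ends at 0, so it descends somewhere *)
have exr : exists r, q r.+1 < q r.
  case: (EM (exists r, q r.+1 < q r)) => // /forallNP nd; exfalso.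
  suff qc i : q i = q 0 by move: qpos; rewrite -(qc l) ql0.
  by elim: i => // i <-; apply/eqP; rewrite eqn_leq dq leqNgt; apply/negP/nd.
case: (ex_minnP exr) => r qr rmin.
have qpred : 0 < r -> q r.-1 = q r.
  move=> r0; have := dq r.-1; have := rmin r.-1; rewrite prednK //; lia.
have rl : r < l.
  by rewrite ltnNge; apply/negP => /(nonincreasingP dq); lia.
have q0 : 0 < q r by exact: leq_ltn_trans qr.
have sumD (F G : nat -> nat) : (forall i, G i <= F i) -> G r < F r ->
    \sum_(i < l) F i < m.+1 -> \sum_(i < l) G i < m.
  move=> GF GFr; rewrite ltnS; apply: leq_trans.
  rewrite (bigD1 (Ordinal rl)) //= [X in _ < X](bigD1 (Ordinal rl)) //=.
  by rewrite -addSn leq_add // leq_sum.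
rewrite (det_hmx_recursion lam mu rl ln q0).
have [|||k1 c1 d1] := IH mu (lower q r) _ dmu _ le _.
- apply: (sumD (fun i => q i + (lam i - mu i))
    (fun i => lower q r i + (lam i - mu i))) sm; last by rewrite /lower eqxx; lia.
  by move=> i; rewrite /lower leq_add2r leq_subr.
- exact: lower_nonincreasing.
- by rewrite /lower ql0.
rewrite -d1; have [radd|nradd] := boolP (addable lam mu r).
- have [|||k2 c2 d2] := IH (add_box mu r) q _ _ dq _ ql0.
  + apply: (sumD (fun i => q i + (lam i - mu i))
      (fun i => q i + (lam i - add_box mu r i))) sm;
      rewrite /add_box; first by move=> i; lia.
    by have /andP[] := radd; rewrite eqxx; lia.
  + exact: add_box_nonincreasing radd.
  + exact: add_box_le.
  exists (k1 + k2); last by rewrite natrD d2.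
  exact: (flagged_addable dmu dq radd qr c1 c2).
- exists k1.
    by apply: eq_has_card c1 => f; rewrite -flagged_not_addable.
  rewrite det_beta_mx_add_box0 ?addr0 // => [j a b ab|r0 a b].
    by rewrite /hcoef ab.
  by rewrite qpred.
Qed.

(** * The determinant for standard tableaux *)

Section StandardRecursion.
Variables (lam mu : nat -> nat) (N : nat).
Hypothesis (dlam : nonincreasing lam) (dmu : nonincreasing mu).

(** A cell to the left of the largest entry, or above it, would contain an even
    larger one. *)
Lemma standard_max f :
  standard lam mu N.+1 f ->
  exists2 r, addable lam mu r & f (r, mu r) = N.+1.
Proof.
move=> [fb fk frow fcol]; have [|[i j] [fx _]] := fk N.+1; first by rewrite /= leqnn.
have ub x : in_skew lam mu x -> f x <= N.+1.
  by move=> Dx; have := fb x; rewrite Dx => /andP[].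
have Dx : in_skew lam mu (i, j).
  by have := fb (i, j); case: ifP => // _; rewrite fx.
have D0 : in_skew lam mu (i, mu i) by move: Dx; rewrite /in_skew /=; lia.
have ej : j = mu i.
  apply/eqP/negP => /negP nj; have := frow i (mu i) j D0 Dx.
  by have := ub _ D0; move: Dx; rewrite /in_skew /=; lia.
exists i; last by rewrite -ej.
rewrite /addable; apply/andP; split; first by move: D0; rewrite /in_skew /=; lia.
case: (posnP i) => //= i0; rewrite ltnNge; apply/negP => lei.
have D1 : in_skew lam mu (i.-1, j).
  by have := dlam i.-1; move: Dx; rewrite /in_skew /= prednK //; lia.
by have := fcol _ _ _ D1 Dx; rewrite ltn_predL i0 fx; have := ub _ D1; lia.
Qed.

Lemma standard_addable r k :
  addable lam mu r -> has_card (standard lam (add_box mu r) N) k ->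
  has_card [set f | standard lam mu N.+1 f /\ f (r, mu r) = N.+1]%classic k.
Proof.
move=> /andP[lr mur].
have D0 : in_skew lam mu (r, mu r) by rewrite /in_skew leqnn.
apply: (has_card_upd (x := (r, mu r)) (v := N.+1)) => [f [[fb fk frow fcol] fx]|
                                                       g [gb gk grow gcol]].
  split=> //; split=> [y|m mN|i j m|i m j]; rewrite ?in_skew_add_box /upd.
  - have := fb y; case: (y =P (r, mu r)) => [_ _|/eqP ny]; first by rewrite andbF.
    rewrite andbT; case: ifP => // Dy /andP[-> yN] /=.
    rewrite -ltnS ltn_neqAle yN andbT; apply: contra ny => /eqP fy.
    have [|z [_ zu]] := fk N.+1; first by rewrite /= leqnn.
    by rewrite -(zu _ fx) -(zu _ fy).
  - have [|z [fz zu]] := fk m; first by lia.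
    exists z; split; first by case: eqP => // zx; move: fz; rewrite zx fx; lia.
    by move=> y; case: eqP => [_ m0|_]; [lia | exact: zu].
  - move=> /andP[Dj /negPf ->] /andP[Dk /negPf ->].
    exact: frow.
  - move=> /andP[Di /negPf ->] /andP[Dk /negPf ->].
    exact: fcol.
have gx : g (r, mu r) = 0.
  by have := gb (r, mu r); rewrite in_skew_add_box eqxx andbF => /eqP.
have gub y : g y <= N by have := gb y; case: ifP => [_ /andP[]|_ /eqP ->].
have Dg y : in_skew lam mu y -> y != (r, mu r) ->
    in_skew lam (add_box mu r) y by rewrite in_skew_add_box => -> ->.
split=> //; split; last by rewrite /upd eqxx.
split=> [y|m mN|i j m Dj Dm jm|i m j Di Dm im]; rewrite /upd.
- have := gb y; rewrite in_skew_add_box.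
  case: (y =P (r, mu r)) => [->|_]; first by rewrite D0 /= leqnn.
  by rewrite andbT; case: ifP => // _; lia.
- have [->|mN1] := eqVneq m N.+1.
    exists (r, mu r); split; first by rewrite eqxx.
    by move=> y; case: eqP => // _ gy; have := gub y; lia.
  have [|z [gz zu]] := gk m; first by lia.
  exists z; split; first by case: eqP => // zx; move: gz; rewrite zx gx; lia.
  by move=> y; case: eqP => [_ m0|_]; [lia | exact: zu].
- case: (@eqP _ (i, m)) => [[ei em]|/eqP nm].
    by move: Dj; rewrite /in_skew /= ei -em; lia.
  case: (@eqP _ (i, j)) => [_|/eqP nj]; first exact: gub.
  by apply: grow => //; apply: Dg.
- case: (@eqP _ (m, j)) => [[em ej]|/eqP nm].
    have ir : i <= r.-1 by lia.
    by have := nonincreasingP dmu ir; move: Di mur im; rewrite /in_skew /=; lia.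
  case: (@eqP _ (i, j)) => [_|/eqP nj]; first exact: gub.
  by apply: gcol => //; apply: Dg.
Qed.

End StandardRecursion.

(** [1 / (a - b)!], read as 0 when [a < b]. *)
Definition inv_fact (a b : nat) : rat :=
  if a < b then 0%R else ((a - b)`!%:R^-1)%R.

Lemma inv_fact_succ a b :
  (inv_fact a b.+1 = (a%:R - b%:R) * inv_fact a b)%R.
Proof.
rewrite /inv_fact ltnS leq_eqVlt; case: ltngtP => [ab|ba|->] /=.
- by rewrite mulr0.
- have [d ->] : exists d, a = b + d.+1 by exists (a - b).-1; lia.
  have -> : b + d.+1 - b.+1 = d by lia.
  have -> : b + d.+1 - b = d.+1 by lia.
  have -> : ((b + d.+1)%:R - b%:R = d.+1%:R :> rat)%R by rewrite natrD addrC addKr.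
  by rewrite factS natrM invfM mulrA divff ?mul1r // pnatr_eq0.
- by rewrite subrr mul0r.
Qed.

Local Notation emx l n lam := (beta_mx l n lam (fun=> inv_fact)).

Lemma sum_beta_sub l n (lam mu : nat -> nat) :
  l <= n -> (forall i, mu i <= lam i) ->
  (\sum_(i < l) (beta n lam i)%:R - \sum_(i < l) (beta n mu i)%:R
   = (\sum_(i < l) (lam i - mu i))%:R :> rat)%R.
Proof.
move=> ln le; rewrite -sumrB natr_sum; apply: eq_bigr => i _.
have := le i; have := ltn_ord i => il lei; rewrite -natrB; last by rewrite /beta; lia.
by congr (_%:R)%R; rewrite /beta; lia.
Qed.

(** Aitken's formula.  Removing the cell with the largest entry adds to [mu] one
    box, and the sum of the determinants over all these boxes is a multiple of
    the original one since [inv_fact a b.+1 = (a - b) * inv_fact a b]. *)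
Theorem standard_count l n lam mu N :
  l <= n -> nonincreasing lam -> nonincreasing mu ->
  (forall i, mu i <= lam i) -> lam l = 0 -> \sum_(i < l) (lam i - mu i) = N ->
  exists2 k, has_card (standard lam mu N) k
    & (k%:R = N`!%:R * \det (emx l n lam mu))%R.
Proof.
move=> ln dlam + + lam0.
have lamz i : l <= i -> lam i = 0 by move/(nonincreasingP dlam); lia.
have inv0 (j a b : nat) : a < b -> inv_fact a b = 0%R by rewrite /inv_fact => ->.
elim: N mu => [|N IH] mu dmu le sN.
  have eml i : mu i = lam i.
    have [il|li] := ltnP i l; last by have := le i; rewrite lamz //; lia.
    have /eqP := sN; rewrite sum_nat_eq0 => /forallP/(_ (Ordinal il)) /=.
    by have := le i; lia.
  exists 1.
    apply: (has_card1 (a := fun=> 0)) => f.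
    have nD x : in_skew lam mu x = false by rewrite /in_skew eml; lia.
    split=> [[fb _ _ _]|->].
      by apply/funext => x; have := fb x; rewrite nD => /eqP.
    by split=> [x|k|i j k|i j k]; rewrite ?nD //; lia.
  rewrite det_beta_mx_diag ?mulr1 // => _ a.
  by rewrite /inv_fact ltnn subnn invr1.
have /fin_all_exists[k kP] (r : 'I_l) : exists k,
    (addable lam mu r -> has_card (standard lam (add_box mu r) N) k) /\
    (k%:R = N`!%:R * \det (emx l n lam (add_box mu r)))%R.
  have [radd|nradd] := boolP (addable lam mu r); last first.
    exists 0; split=> //; rewrite det_beta_mx_add_box0 ?mulr0 //.
  have [|||k ck dk] := IH (add_box mu r); last by exists k.
  - exact: add_box_nonincreasing radd.
  - exact: add_box_le.
  - have /andP[lr _] := radd.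
    move: sN; rewrite (bigD1 r) //= [in X in _ -> X](bigD1 r) //= => sN.
    rewrite [X in _ + X](eq_bigr (fun i : 'I_l => lam i - mu i)).
      by move: sN; rewrite /add_box eqxx; lia.
    by move=> i ir; rewrite /add_box [_ == _](negbTE ir) addn0.
exists (\sum_(r < l | addable lam mu r) k r).
  apply: (has_card_sum (A := fun r : 'I_l =>
    [set f | standard lam mu N.+1 f /\ f (val r, mu r) = N.+1]%classic)).
  - move=> f; split=> [sf|[r _ []//]].
    have [r radd fr] := standard_max dlam sf.
    have rl : r < l.
      by rewrite ltnNge; apply/negP => /lamz lz; move: radd; rewrite /addable lz.
    by exists (Ordinal rl).
  - move=> i j f [[_ fk _ _] fi] [_ fj]; apply/val_inj.
    have [|z [_ zu]] := fk N.+1; first by rewrite /= leqnn.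
    by have := zu _ fi; rewrite (zu _ fj) => -[eji _]; apply/esym.
  - by move=> r radd; apply: standard_addable => //; apply: (kP r).1.
rewrite natr_sum big_mkcond /=.
transitivity (\sum_(r < l) N`!%:R * \det (emx l n lam (add_box mu r)))%R.
  apply: eq_bigr => r _; case: ifPn => [_|nradd]; first exact: (kP r).2.
  by rewrite det_beta_mx_add_box0 ?mulr0.
rewrite -mulr_sumr.
rewrite (sum_det_scaled_row (M := emx l n lam mu)
  (a := fun i => (beta n lam i)%:R%R) (b := fun i => (beta n mu i)%:R%R)).
- by rewrite sum_beta_sub // sN mulrA -natrM mulnC -factS.
- move=> r j; rewrite !mxE -inv_fact_succ; congr inv_fact.
  by rewrite /beta /add_box eqxx; have := ltn_ord r; lia.
- move=> r i j ir; rewrite !mxE; congr inv_fact.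
  by rewrite /beta /add_box [_ == _](negbTE ir) addn0.
Qed.

Lemma bin_inv_fact a b :
  ('C(a, b)%:R = (b`!%:R)^-1 * inv_fact a b * a`!%:R :> rat)%R.
Proof.
rewrite /inv_fact; case: ltnP => [/bin_small ->|ba]; first by rewrite mulr0 mul0r.
rewrite -(bin_fact ba) !natrM mulrC -invfM mulfK //.
by rewrite mulf_neq0 // pnatr_eq0 -lt0n fact_gt0.
Qed.

(** * Back to tableaux on diagrams *)

Section Transport.
Variables (D : {fset nat * nat}) (lam mu : nat -> nat).
Hypothesis DE : forall i j,
  ((i, j) \in D) = [&& 0 < i, 0 < j & in_skew lam mu (i.-1, j.-1)].

Definition extend (T : {ffun D -> nat}) : nat * nat -> nat :=
  fun x => if insub (x.1.+1, x.2.+1) is Some y then T y else 0.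

Definition cell (y : D) : nat * nat := ((val y).1.-1, (val y).2.-1).

Definition crop (f : nat * nat -> nat) : {ffun D -> nat} :=
  [ffun y => f (cell y)].

Lemma cellP y : in_skew lam mu (cell y).
Proof.
by have := valP y; rewrite /cell; case: (val y) => i j; rewrite DE => /and3P[].
Qed.

Lemma val_cell y : val y = ((cell y).1.+1, (cell y).2.+1).
Proof.
have := valP y; rewrite /cell; case: (val y) => i j.
rewrite DE /= => /and3P[i0 j0 _].
by rewrite !prednK.
Qed.

Lemma cell_inj : injective cell.
Proof. by move=> y z e; apply: val_inj; rewrite !val_cell e. Qed.

Lemma cell_surj x : in_skew lam mu x -> exists y, cell y = x.
Proof.
move=> Dx; have Dx' : (x.1.+1, x.2.+1) \in D by rewrite DE /= -surjective_pairing.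
by exists (FSetSub Dx'); rewrite /cell /= -surjective_pairing.
Qed.

Lemma extend_cell T y : extend T (cell y) = T y.
Proof. by rewrite /extend -val_cell valK. Qed.

Lemma extend0 T x : ~~ in_skew lam mu x -> extend T x = 0.
Proof.
move=> nDx; rewrite /extend insubN // DE /=.
by rewrite -surjective_pairing.
Qed.

Lemma extendK T : crop (extend T) = T.
Proof. by apply/ffunP => y; rewrite ffunE extend_cell. Qed.

Lemma cropK f : (forall x, ~~ in_skew lam mu x -> f x = 0) -> extend (crop f) = f.
Proof.
move=> f0; apply/funext => x; have [Dx|nDx] := boolP (in_skew lam mu x).
  by have [y <-] := cell_surj Dx; rewrite extend_cell ffunE.
by rewrite extend0 // f0.
Qed.

Lemma same_row_cell (x y : D) :
  same_row_lt x y <-> (cell x).1 = (cell y).1 /\ (cell x).2 < (cell y).2.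
Proof. by rewrite /same_row_lt !val_cell /= ltnS; split=> -[e ?]; split; lia. Qed.

Lemma same_col_cell (x y : D) :
  same_col_lt x y <-> (cell x).2 = (cell y).2 /\ (cell x).1 < (cell y).1.
Proof. by rewrite /same_col_lt !val_cell /= ltnS; split=> -[e ?]; split; lia. Qed.

(** Rows decrease weakly, so the content bound on a whole row amounts to the
    bound on its first cell. *)
Lemma SSCT_card n l k :
  l <= n -> (forall i, l <= i -> lam i = 0) ->
  has_card (flagged lam mu (fun i => if i < l then (beta n mu i).+1 else 0)) k ->
  has_card (SSCT D n) k.
Proof.
move=> ln lamz; apply: (has_card_bij (f := crop) (g := extend)).
- move=> f [f0 frow fcol ff]; split; last exact: cropK.
  split=> [x y /same_row_cell[exy lxy]|x y /same_col_cell[exy lxy]|x]; rewrite !ffunE.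
  + have := cellP x; have := cellP y; move: exy lxy.
    by case: (cell x) (cell y) => [i j] [_ j'] /= <- lt Dy Dx; apply: frow.
  + have := cellP x; have := cellP y; move: exy lxy.
    by case: (cell x) (cell y) => [i j] [i' _] /= <- lt Dy Dx; apply: fcol.
  + have := cellP x; rewrite val_cell; case: (cell x) => i j /= Dx.
    have := ff _ _ Dx; have := lamz i; move: Dx; rewrite /in_skew /beta /=.
    by move=> Dm lz; case: (ltnP i l) => [|/lz]; lia.
- move=> T [Trow Tcol Tb]; split; last exact: extendK.
  have row i j j' : in_skew lam mu (i, j) -> in_skew lam mu (i, j') ->
      j < j' -> extend T (i, j') <= extend T (i, j).
    move=> /cell_surj[x ex] /cell_surj[y ey] lt.
    by rewrite -ex -ey !extend_cell; apply/Trow/same_row_cell; rewrite ex ey.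
  split=> // [x|i i' j|i j Dx].
  + exact: extend0.
  + move=> /cell_surj[x ex] /cell_surj[y ey] lt.
    by rewrite -ex -ey !extend_cell; apply/Tcol/same_col_cell; rewrite ex ey.
  + have il : i < l.
      by rewrite ltnNge; apply/negP => /lamz; move: Dx; rewrite /in_skew /=; lia.
    have D0 : in_skew lam mu (i, mu i) by move: Dx; rewrite /in_skew /=; lia.
    have f0 : extend T (i, mu i) < (beta n mu i).+1.
      have [y ey] := cell_surj D0; have := Tb y.
      by rewrite val_cell -ey extend_cell ey /beta /=; lia.
    rewrite il; have [->//|nj] := eqVneq j (mu i).
    by apply: leq_ltn_trans f0; apply: row => //; move: Dx; rewrite /in_skew /=; lia.
Qed.

(** The cells that carry the values from 1 to [#|` D|] already exhaust [D]. *)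
Lemma SYT_bounds (T : {ffun D -> nat}) y : is_SYT T -> 0 < T y <= #|` D|.
Proof.
case=> oneT _ _.
have /fin_all_exists[g gK] (k : 'I_#|` D|) : exists x, T x = k.+1.
  have [|x [Tx _]] := oneT k.+1; first exact: ltn_ord.
  by exists x.
have g_inj : injective g.
  by move=> i j eqg; apply/val_inj/succn_inj; rewrite -!gK eqg.
have : y \in codom g by rewrite inj_card_onto // card_ord cardfE.
by case/codomP=> k ->; rewrite gK /= ltn_ord.
Qed.

Lemma SYT_card k :
  has_card (standard lam mu #|` D|) k -> has_card (SYT D) k.
Proof.
apply: (has_card_bij (f := crop) (g := extend)).
- move=> f [fb fk frow fcol]; split; last first.
    by apply: cropK => x nDx; have := fb x; rewrite (negPf nDx) => /eqP.
  split=> [m mD|x y /same_row_cell[exy lxy]|x y /same_col_cell[exy lxy]].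
  + have [x [fx xu]] := fk m mD.
    have [y ey] : exists y, cell y = x.
      by apply: cell_surj; have := fb x; case: ifP => // _; rewrite fx; lia.
    exists y; split; first by rewrite ffunE ey.
    by move=> z; rewrite ffunE => /xu; rewrite -ey => /cell_inj.
  + rewrite !ffunE; have := cellP x; have := cellP y; move: exy lxy.
    by case: (cell x) (cell y) => [i j] [_ j'] /= <- lt Dy Dx; apply: frow.
  + rewrite !ffunE; have := cellP x; have := cellP y; move: exy lxy.
    by case: (cell x) (cell y) => [i j] [i' _] /= <- lt Dy Dx; apply: fcol.
- move=> T sT; have [oneT Trow Tcol] := sT; split; last exact: extendK.
  split=> [x|m mD|i j j'|i i' j].
  + case: ifPn => [/cell_surj[y <-]|/extend0 ->//].
    by rewrite extend_cell SYT_bounds.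
  + have [y [Ty yu]] := oneT m mD; exists (cell y).
    split; first by rewrite extend_cell.
    move=> x; have [/cell_surj[z <-]|nDx] := boolP (in_skew lam mu x).
      by rewrite extend_cell => /yu ->.
    by rewrite extend0 // => m0; move: mD; rewrite -m0.
  + move=> /cell_surj[x ex] /cell_surj[y ey] lt.
    by rewrite -ex -ey !extend_cell; apply/Trow/same_row_cell; rewrite ex ey.
  + move=> /cell_surj[x ex] /cell_surj[y ey] lt.
    by rewrite -ex -ey !extend_cell; apply/Tcol/same_col_cell; rewrite ex ey.
Qed.

Variable l : nat.
Hypothesis lamz : forall i, l <= i -> lam i = 0.

Lemma perm_cells :
  perm_eq D [seq (i.+1, j.+1) | i <- iota 0 l, j <- iota (mu i) (lam i - mu i)].
Proof.
apply: uniq_perm; first exact: fset_uniq.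
  apply: allpairs_uniq_dep => [|i _|]; try exact: iota_uniq.
  by move=> [i j] [i' j'] _ _ /= [-> ->].
case=> i j; rewrite DE; apply/and3P/allpairsPdep => [[i0 j0 Dij]|[i' [j' []]]].
  exists i.-1, j.-1; rewrite !prednK // !mem_iota; split=> //.
    by rewrite add0n /= ltnNge; apply/negP => /lamz; move: Dij; rewrite /in_skew /=; lia.
  by move: Dij; rewrite /in_skew /=; lia.
by rewrite !mem_iota => _ + [-> ->]; rewrite /in_skew /=; split=> //; lia.
Qed.

Lemma card_cells : #|` D| = \sum_(i < l) (lam i - mu i).
Proof.
rewrite (perm_size perm_cells) size_allpairs_dep sumnE big_map -{1}[l]subn0.
rewrite -/(index_iota 0 l) big_mkord.
by apply: eq_bigr => i _; rewrite size_iota.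
Qed.

Lemma prod_contents n :
  l <= n -> (forall i, mu i <= lam i) ->
  (\prod_(x <- D) (n%:Z + content x)%:~R =
   \prod_(i < l) (beta n lam i)`!%:R / \prod_(i < l) (beta n mu i)`!%:R :> rat)%R.
Proof.
move=> ln le; rewrite (perm_big _ perm_cells) big_allpairs_dep /=.
rewrite -{1}[l]subn0 -/(index_iota 0 l) big_mkord -prodf_div.
apply: eq_bigr => i _; have il := ltn_ord i; rewrite /beta -{2}(subnKC (le i)).
elim: (lam i - mu i) => [|d IH].
  by rewrite big_nil addn0 divff // pnatr_eq0 -lt0n fact_gt0.
rewrite -addn1 iotaD big_cat big_seq1 /= {}IH.
have -> : mu i + (d + 1) + n - i.+1 = (mu i + d + n - i.+1).+1 by lia.
rewrite factS natrM mulrC mulrA; congr (_ * _ / _)%R.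
by rewrite pmulrn /content /=; congr (_%:~R)%R; lia.
Qed.

End Transport.

Lemma mem_diagram la i j :
  ((i, j) \in diagram la) = [&& 0 < i, 0 < j & j <= nth 0 la i.-1].
Proof.
rewrite /diagram in_fset /=; apply/allpairsPdep/and3P => [[i' [j' []]]|[i0 j0 jla]].
  by rewrite !mem_iota /part => ? ? [-> ->]; split; lia.
exists i, j; rewrite !mem_iota /part; split=> //; last by lia.
rewrite i0 /= add1n ltnS leqNgt; apply/negP => lt.
by move: jla; rewrite nth_default; lia.
Qed.

Lemma partition_nonincreasing la : is_partition la -> nonincreasing (nth 0 la).
Proof.
case/andP => sla _ i; have [|lai] := ltnP i.+1 (size la); last by rewrite nth_default.
have tr : transitive geq by move=> y x z xy yz; apply: leq_trans yz xy.
move=> lti; apply: (sorted_ltn_nth tr 0 sla) => //; rewrite ?inE //.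
exact: ltnW.
Qed.

Local Open Scope ring_scope.

(* A matrix index i : 'I_l stands for the row or column number i.+1. *)
Theorem proposition1p2 (la mu : seq nat) (n : nat)
  (hla : is_partition la) (hmu : is_partition mu)
  (hsub : (diagram mu `<=` diagram la)%fset)
  (hn : (size la <= n)%N) :
  let D := skew_diagram la mu in
  let M : 'M[rat]_(size la) :=
    \matrix_(i < size la, j < size la)
      ('C(part la i.+1 + n - i.+1, part mu j.+1 + n - j.+1))%N%:R in
  (num_SSCT n D)%:R = \det M /\
  \det M = (num_SYT D)%:R / ((#|` D|)`!)%:R
           * \prod_(x <- D) (n%:Z + content x)%:~R.
Proof.
move=> D M; pose l := size la; pose lam := nth 0%N la; pose nu := nth 0%N mu.
have dlam := partition_nonincreasing hla; have dnu := partition_nonincreasing hmu.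
have lamz i : (l <= i)%N -> lam i = 0%N by move=> li; rewrite /lam nth_default.
have le i : (nu i <= lam i)%N.
  case: (posnP (nu i)) => [->//|nu0].
  have : (i.+1, nu i) \in diagram mu by rewrite mem_diagram nu0 /=.
  by move=> /(fsubsetP hsub); rewrite mem_diagram => /and3P[].
have DE i j :
    ((i, j) \in D) = [&& (0 < i)%N, (0 < j)%N & in_skew lam nu (i.-1, j.-1)].
  rewrite in_fsetD !mem_diagram /in_skew /= -/lam -/nu.
  by apply/idP/idP; lia.
pose q i := if (i < l)%N then (beta n nu i).+1 else 0%N.
have dq : nonincreasing q.
  move=> i; rewrite /q; case: (ltnP i.+1 l) => // il; rewrite (ltnW il) ltnS.
  by apply: ltnW; apply: beta_lt => //; apply: leq_trans il hn.
have [|k1 c1 d1] := flagged_count hn dlam dnu dq le (lamz _ (leqnn _)) _.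
  by rewrite /q ltnn.
have [k2 c2 d2] := standard_count hn dlam dnu le (lamz _ (leqnn _)) erefl.
have ME : \det M = \det (beta_mx l n lam (fun j a b => (hcoef (q j) a b)%:R) nu).
  rewrite -det_tr; congr (\det _); apply/matrixP => i j.
  by rewrite !mxE /q ltn_ord hcoef_bin.
have cSS : num_SSCT n D = k1 by apply/card_fset_set/(SSCT_card DE hn lamz c1).
have cSY : num_SYT D = k2.
  by apply/card_fset_set/(SYT_card DE); rewrite (card_cells DE lamz).
rewrite cSS cSY ME -d1; split=> //.
have fact0 m : m`!%:R != 0 :> rat by rewrite pnatr_eq0 -lt0n fact_gt0.
rewrite d2 (card_cells DE lamz) (prod_contents DE lamz hn le) d1.
rewrite [X in X / _]mulrC mulfK //.
have -> : beta_mx l n lam (fun j a b => (hcoef (q j) a b)%:R) nu =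
    \matrix_(j, i) (((beta n nu j)`!%:R)^-1
                      * beta_mx l n lam (fun=> inv_fact) nu j i
                      * (beta n lam i)`!%:R).
  by apply/matrixP => j i; rewrite !mxE /q ltn_ord hcoef_bin bin_inv_fact.
by rewrite det_scale_rows_cols prodfV mulrAC mulrC [X in _ * X]mulrC.
Qed.
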